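(* Let $q$ be a positive integer. If $q\le 4$, then for every positive integer $p$ the complete tripartite graph $K_{p,q,1}$ is $S$-determined. If $q>4$, then there exists a positive integer $p$ such that $K_{p,q,1}$ is not $S$-determined.
   Context: All graphs are finite and simple. For a graph $G$, the Seidel matrix is $S(G)=J-I-2A(G)$, where $A(G)$ is the adjacency matrix, $J$ the all-ones matrix and $I$ the identity; its eigenvalue multiset is the Seidel spectrum of $G$. For a partition $V(G)=U\cup W$, Seidel switching with respect to $U$ deletes all edges between $U$ and $W$ and adds an edge between $u\in U$, $w\in W$ whenever $uw$ was not an edge. Two graphs are switching equivalent if one is obtained from the other by a Seidel switching. A graph $G$ is $S$-determined if every graph with the same Seidel spectrum as $G$ is switching equivalent to a graph isomorphic to $G$. *)

(* Defs.v *)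
From HB Require Import structures.
From mathcomp Require Import all_boot all_order all_algebra all_field.

Set Implicit Arguments.
Unset Strict Implicit.
Unset Printing Implicit Defensive.

Import GRing.Theory.

Record sgraph (T : finType) := SGraph {
  adj : rel T;
  adj_sym : symmetric adj;
  adj_irr : irreflexive adj
}.

Definition isomorphic (T T' : finType) (G : sgraph T) (H : sgraph T') : Prop :=
  exists2 f : T -> T', bijective f & forall x y, adj H (f x) (f y) = adj G x y.

Section Seidel.
Local Open Scope ring_scope.

(* Rows and columns follow the enumeration of T; another ordering would
   conjugate the matrices by a permutation, leaving the spectrum unchanged. *)
Definition adjacency_mx (T : finType) (G : sgraph T) : 'M[algC]_#|T| :=
  \matrix_(i, j) (adj G (enum_val i) (enum_val j))%:R.

Definition seidel_mx (T : finType) (G : sgraph T) : 'M[algC]_#|T| :=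
  const_mx 1 - 1%:M - 2%:R *: adjacency_mx G.

(* The roots of the characteristic polynomial, listed with multiplicity. The
   order of the list is arbitrary: compare spectra with perm_eq only. *)
Definition spectrum (n : nat) (A : 'M[algC]_n) : seq algC :=
  sval (closed_field_poly_normal (char_poly A)).

Definition seidel_cospectral (T T' : finType) (G : sgraph T) (H : sgraph T') :=
  perm_eq (spectrum (seidel_mx G)) (spectrum (seidel_mx H)).

End Seidel.

Section Switching.
Variables (T : finType) (G : sgraph T) (U : {set T}).

Definition switch_adj : rel T :=
  fun x y => if (x \in U) == (y \in U) then adj G x y else ~~ adj G x y.

Lemma switch_adj_sym : symmetric switch_adj.
Proof. by move=> x y; rewrite /switch_adj eq_sym (adj_sym G). Qed.

Lemma switch_adj_irr : irreflexive switch_adj.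
Proof. by move=> x; rewrite /switch_adj eqxx (adj_irr G). Qed.

Definition switching : sgraph T := SGraph switch_adj_sym switch_adj_irr.

End Switching.

(* Equality of graphs on T is stated as =2 of the adjacency relations. U may be
   empty or full, so that a graph is switching equivalent to itself. *)
Definition switching_equivalent (T : finType) (G H : sgraph T) : Prop :=
  exists U : {set T}, adj H =2 adj (switching G U).

Definition S_determined (T : finType) (G : sgraph T) : Prop :=
  forall (T' : finType) (H : sgraph T'), seidel_cospectral H G ->
  exists2 G' : sgraph T', switching_equivalent H G' & isomorphic G' G.

Section CompleteMultipartite.
Variable s : seq nat.

(* A vertex is a pair (i, k): the k-th vertex of the part of index i. *)
Definition multipartite_vertex : finType :=
  {i : 'I_(size s) & 'I_(nth 0 s i)}.

Definition multipartite_adj : rel multipartite_vertex :=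
  fun x y => tag x != tag y.

Lemma multipartite_adj_sym : symmetric multipartite_adj.
Proof. by move=> x y; rewrite /multipartite_adj eq_sym. Qed.

Lemma multipartite_adj_irr : irreflexive multipartite_adj.
Proof. by move=> x; rewrite /multipartite_adj eqxx. Qed.

Definition complete_multipartite : sgraph multipartite_vertex :=
  SGraph multipartite_adj_sym multipartite_adj_irr.

End CompleteMultipartite.

(* Main.v *)
Require Import Defs.
From mathcomp Require Import all_boot all_order all_algebra all_field.
From mathcomp Require Import perm ring zify.

(** The matrix [M = S + I] has entries [(-1)^adj].  For [K_{p,q,r}] it factors
    through a 3x3 matrix, so it has rank 3, and Sylvester's determinant identity
    shows that the Seidel spectrum is equivalent to the pair
    [(p + q + r, p * q * r)].  Conversely, let [H] be cospectral with
    [K_{p,q,r}].  As [S(H)] is real symmetric, [M(H)] has rank 3, hence there is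
    a triple [x, y, z] with an odd number of edges; the rows of [x, y, z] form a
    basis of the row space, and solving for the coefficients of an arbitrary row
    shows that it equals, up to sign, one of the three rows.  So [H] is, up to
    switching, complete tripartite, and the question becomes whether the sum and
    the product determine the parts.  For [r = 1], [q <= 4] they do; for [q > 4]
    the triples [(k, q k, 2)] ([q = 2k+1]) and [(k-1, k^2, 2)] ([q = 2k]) have the
    sum and product of [(p, q, 1)] with [p = 2k^2], respectively [p = k(k-1)]. *)

Set Implicit Arguments.
Unset Strict Implicit.
Unset Printing Implicit Defensive.

Import GRing.Theory Num.Theory.
Local Open Scope ring_scope.

(** * Arithmetic of triples with prescribed sum and product *)

Lemma sum_prod_perm2 (p q x y : nat) :
  (x + y = p + q)%N -> (x * y = p * q)%N -> perm_eq [:: x; y] [:: p; q].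
Proof.
move=> xy xy'; have e : (x * x + p * q = x * p + x * q)%N.
  by rewrite -xy' -!mulnDr xy.
(* [x] is a root of the monic quadratic with roots [p] and [q]. *)
have /eqP : (x%:Z - p%:Z) * (x%:Z - q%:Z) = 0 by lia.
rewrite mulf_eq0 !subr_eq0 => /orP[] /eqP[xE]; subst x.
  by have -> : y = q by lia.
have -> : y = p by lia.
by apply/seq.permP => k /=; lia.
Qed.

Lemma sum_prod_perm3 (p q a b d : nat) : (0 < q <= 4)%N -> (0 < p)%N ->
  (a + b + d = p + q + 1)%N -> (a * b * d = p * q * 1)%N ->
  perm_eq [:: a; b; d] [:: p; q; 1%N].
Proof.
move=> /andP[q0 q4] p0 sE pE.
have red x y : (x + y + 1 = a + b + d)%N -> (x * y * 1 = a * b * d)%N ->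
    perm_eq [:: x; y; 1%N] [:: p; q; 1%N].
  rewrite sE pE !muln1 => /addIn sxy pxy.
  by have := sum_prod_perm2 sxy pxy; rewrite -(perm_cat2r [:: 1%N]).
have [E|a1] := eqVneq a 1%N.
  subst; have := red b d; move/(_ ltac:(lia) ltac:(lia)).
  by apply: perm_trans; apply/seq.permP => k /=; lia.
have [E|b1] := eqVneq b 1%N.
  subst; have := red a d; move/(_ ltac:(lia) ltac:(lia)).
  by apply: perm_trans; apply/seq.permP => k /=; lia.
have [E|d1] := eqVneq d 1%N.
  subst; have := red a b; move/(_ ltac:(lia) ltac:(lia)).
  by apply: perm_trans; apply/seq.permP => k /=; lia.
have : (0 < a * b * d)%N by rewrite pE !muln_gt0 p0 q0.
rewrite !muln_gt0 => /andP[/andP[a0 b0] d0].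
have [x ax] : exists x, a = x.+2 by exists (a - 2)%N; lia.
have [y by_] : exists y, b = y.+2 by exists (b - 2)%N; lia.
have [z dz] : exists z, d = z.+2 by exists (d - 2)%N; lia.
subst a b d.
(* All three entries are at least 2; eliminating [p] now gives a contradiction. The right side is at
   least [4 * (x + y + z) + 8 + q^2 + q], which exceeds the left side because [q <= 4] and
   [q^2 - 5q + 8 > 0]. *)
have : (q * (x.+2 + y.+2 + z.+2) = x.+2 * y.+2 * z.+2 + q * q + q)%N.
  by rewrite sE pE; lia.
have := leq0n (x * y * z); have := leq0n (x * y).
have := leq0n (x * z); have := leq0n (y * z).
have : q \in [:: 1; 2; 3; 4]%N by rewrite !inE; lia.
by rewrite !inE => /or4P[] /eqP ->; lia.
Qed.

Lemma sum_prod_witness (q : nat) : (4 < q)%N ->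
  exists p a b, [/\ 0 < p, 1 < a, 1 < b, a + b + 2 = p + q + 1
                  & a * b * 2 = p * q * 1]%N.
Proof.
move=> q4; have := odd_double_half q; case: (odd q) => /= qE.
  exists (2 * (q./2 * q./2))%N, q./2, (q * q./2)%N.
  move: (q./2) qE => k kE; subst q; have k2 : (1 < k)%N by lia.
  by split; nia.
exists (q./2 * q./2.-1)%N, q./2.-1, (q./2 * q./2)%N.
move: (q./2) qE => [|k] kE; first by exfalso; lia.
have k2 : (1 < k)%N by lia.
subst q; rewrite /=; split; nia.
Qed.

(** * Determinant identities, and rank against eigenvalue multiplicity *)

Lemma det_mx33 (R : comNzRingType) (A : 'M[R]_3) :
  \det A = A 0 0 * (A 1 1 * A 2 2 - A 1 2 * A 2 1)
         - A 0 1 * (A 1 0 * A 2 2 - A 1 2 * A 2 0)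
         + A 0 2 * (A 1 0 * A 2 1 - A 1 1 * A 2 0).
Proof.
pose f (i j : nat) := A (inord i) (inord j).
have Af i j : A i j = f i j by rewrite /f !inord_val.
do 2!rewrite !(expand_det_row _ ord0) !big_ord_recl !big_ord0 /cofactor.
rewrite !det_mx11 !mxE !Af /= /bump /=; ring.
Qed.

(** Two block-triangular multipliers evaluate [\det K] in two ways, one clearing [B] and the other
    clearing [A]. The powers of [y] avoid any division. *)
Lemma sylvester_det (R : comNzRingType) (n m : nat) (y : R)
    (A : 'M[R]_(n, m)) (B : 'M[R]_(m, n)) :
  y ^+ m * \det (y%:M - A *m B) = y ^+ n * \det (y%:M - B *m A).
Proof.
pose K : 'M_(n + m) := block_mx y%:M A B 1%:M.
have E1 : \det K = \det (y%:M - A *m B).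
  have := det_mulmx K (block_mx 1%:M 0 (- B) 1%:M).
  rewrite mulmx_block det_lblock !det1 !mulr1 !mulmx1 !mulmx0 !mul1mx !add0r.
  by rewrite mulmxN subrr det_ublock det1 mulr1 => <-.
have := det_mulmx K (block_mx 1%:M (- A) 0 y%:M).
rewrite mulmx_block det_ublock !det1 mul1r !mulmx1 !mulmx0 !addr0 !mulmxN.
rewrite mul1mx mul_scalar_mx mul_mx_scalar addNr.
by rewrite det_lblock !det_scalar E1 (addrC (- _)) => ->; rewrite mulrC.
Qed.

Lemma mxrank_diag (F : fieldType) n (d : 'rV[F]_n) :
  \rank (diag_mx d) = #|[pred i | d 0 i != 0]|.
Proof.
have -> : \rank (diag_mx d) =
    \rank (\sum_(i | d ord0 i != 0%R) <<delta_mx 0 i : 'rV[F]_n>>)%MS.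
  apply/eqmx_rank/andP; split.
    apply/row_subP => i; rewrite row_diag_mx.
    have [->|di] := eqVneq (d 0 i) 0; first by rewrite scale0r sub0mx.
    by apply/scalemx_sub/(sumsmx_sup i) => //; rewrite genmxE.
  apply/sumsmx_subP => i di; rewrite genmxE.
  rewrite -[delta_mx 0 i]scale1r -(mulVf di) -scalerA -row_diag_mx.
  exact/scalemx_sub/row_sub.
rewrite (mxdirectP (mxdirect_delta _ _)) //=.
under eq_bigr do rewrite genmxE mxrank_delta.
by rewrite sum1_card.
Qed.

Lemma char_poly_mulmxC (F : fieldType) n (A B : 'M[F]_n) :
  char_poly (A *m B) = char_poly (B *m A).
Proof.
rewrite /char_poly /char_poly_mx !map_mxM /=.
have Xn0 : 'X^n != 0 :> {poly F} by rewrite expf_neq0 ?polyX_eq0.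
exact/(mulfI Xn0)/sylvester_det.
Qed.

(** After unitary diagonalization the rank counts the diagonal entries other than [a], and the
    multiplicity counts those equal to [a]. *)
Lemma normalmx_rank_shift (C : numClosedFieldType) n (A : 'M[C]_n) a :
  A \is normalmx -> (\rank (A - a%:M)%R + mup a (char_poly A))%N = n.
Proof.
move=> /orthomx_spectralP; set P := spectralmx A; set d := spectral_diag A => E.
have Pu : P \in unitmx by apply: spectral_unit.
have -> : A - a%:M = invmx P *m diag_mx (d - const_mx a) *m P.
  rewrite linearB /= diag_const_mx mulmxBr mulmxBl -E; congr (_ - _).
  by rewrite mul_mx_scalar -scalemxAl mulVmx // scalemx1.
rewrite mxrankMfree ?row_free_unit //.
rewrite (eqmxMfull _ _) ?row_full_unit ?unitmx_inv // mxrank_diag.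
rewrite {1}E -mulmxA char_poly_mulmxC -mulmxA mulmxV // mulmx1.
rewrite char_poly_trig ?diag_mx_is_trig // -big_enum /=.
rewrite -(big_map (fun i => diag_mx d i i) xpredT (fun x => 'X - x%:P)).
rewrite mu_prod_XsubC count_map -[RHS]card_ord -(cardC [pred i | d 0 i == a]).
rewrite addnC; congr (_ + _)%N.
  rewrite cardE -size_filter /enum_mem -filter_predI; congr size.
  by apply: eq_filter => i; rewrite !inE /= mxE eqxx andbT.
by apply: eq_card => i; rewrite !inE !mxE subr_eq0.
Qed.

(** * The sign matrix, its rank, and odd triples *)

Definition sign_mx (T : finType) (G : sgraph T) : 'M[algC]_#|T| :=
  \matrix_(i, j) (-1) ^+ adj G (enum_val i) (enum_val j).

Lemma seidel_mxE (T : finType) (G : sgraph T) :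
  seidel_mx G = sign_mx G - 1%:M.
Proof.
apply/matrixP => i j; rewrite !mxE.
by case: (adj G _ _); case: (i == j); rewrite /= ?expr0 ?expr1; ring.
Qed.

Lemma seidel_mx_normal (T : finType) (G : sgraph T) : seidel_mx G \is normalmx.
Proof.
apply/hermitian_normalmx/realsym_hermsym.
  apply/is_hermitianmxP; rewrite expr0 scale1r map_mx_id //.
  apply/matrixP => i j; rewrite seidel_mxE !mxE (adj_sym G).
  by rewrite [j == i]eq_sym.
apply/mxOverP => i j; rewrite seidel_mxE !mxE.
by rewrite rpredB ?rpredX ?rpredN ?rpred1 ?realn.
Qed.

(** This makes the rank of the sign matrix an invariant of the Seidel spectrum. *)
Lemma seidel_rank (T : finType) (G : sgraph T) :
  (\rank (sign_mx G) + mup (- 1) (char_poly (seidel_mx G)))%N = #|T|.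
Proof.
rewrite -[RHS](normalmx_rank_shift (- 1) (seidel_mx_normal G)).
congr (\rank _ + _)%N.
by rewrite seidel_mxE raddfN /= opprK subrK.
Qed.

(* These triples form the two-graph of G: they are invariant under switching. *)
Definition odd3 (T : finType) (G : sgraph T) x y z :=
  adj G x y (+) adj G y z (+) adj G x z.

Lemma exists_odd3 (T : finType) (G : sgraph T) :
  (1 < \rank (sign_mx G))%N -> exists x y z, odd3 G x y z.
Proof.
have [|/negP ev] := boolP [exists x, exists y, exists z, odd3 G x y z].
  by move=> /existsP[x /existsP[y /existsP[z xyz]]] _; exists x, y, z.
suff : (\rank (sign_mx G) <= 1)%N by rewrite leqNgt => /negP.
have [n0|/card_gt0P[x _]] := posnP #|T|.
  by rewrite (leq_trans (rank_leq_row _)) // n0.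
(* If every triple through [x] is even, each entry is the product of the entries leading to and from
   [x], so the matrix is an outer product. *)
rewrite (_ : sign_mx G =
  (\col_i (-1) ^+ adj G (enum_val i) x)
    *m (\row_j (-1) ^+ adj G x (enum_val j))).
  exact: leq_trans (mxrankM_maxl _ _) (rank_leq_col _).
apply/matrixP => i j; rewrite !mxE big_ord1 !mxE -signr_addb; congr (_ ^+ _).
apply/eqP/negPn/negP => ne; apply: ev; apply/existsP; exists (enum_val i).
apply/existsP; exists x; apply/existsP; exists (enum_val j); move: ne.
by rewrite /odd3; do 3!case: (adj _ _ _).
Qed.

Section OddTriple.
Variables (T : finType) (G : sgraph T) (x y z : T).
Hypothesis xyz : odd3 G x y z.

Let t (i : 'I_3) : T := nth x [:: x; y; z] i.
Let R := rowsub (enum_rank \o t) (sign_mx G).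

Lemma odd3_rank : \rank R = 3%N.
Proof.
apply/eqP; rewrite eqn_leq rank_leq_row /=.
suff : \rank (colsub (enum_rank \o t) R) = 3%N.
  move=> rQ; rewrite -[X in (X <= _)%N]rQ -{1}[R]mulmx1 -mulmx_colsub.
  exact: mxrankM_maxl.
rewrite mxrank_unit // unitmxE unitfE det_mx33 !mxE /= !enum_rankK.
rewrite !(adj_irr G) (adj_sym G y x) (adj_sym G z x) (adj_sym G z y).
(* With off-diagonal signs [a], [b], [c] the minor is [1 + 2abc - a^2 - b^2 - c^2]; oddness means
   [abc = -1], hence the value -4. *)
have n4 : - 4%:R != 0 :> algC by rewrite oppr_eq0 pnatr_eq0.
apply: contraNneq n4 => e; apply/eqP; rewrite -[RHS]e.
move: xyz; rewrite /odd3.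
by case: (adj G x y); case: (adj G y z); case: (adj G x z) => // _;
  rewrite /= ?expr0 ?expr1; ring.
Qed.

Lemma odd3_sub : (R <= sign_mx G)%MS.
Proof. exact: rowsub_sub. Qed.

Lemma odd3_rank_ge3 : (3 <= \rank (sign_mx G))%N.
Proof. by rewrite -[X in (X <= _)%N]odd3_rank (mxrankS odd3_sub). Qed.

Hypothesis rk : (\rank (sign_mx G) <= 3)%N.

Lemma odd3_span v : exists w : 'rV[algC]_3, forall u,
  (-1) ^+ adj G v u = w 0 0 * (-1) ^+ adj G x u + w 0 1 * (-1) ^+ adj G y u
                      + w 0 2 * (-1) ^+ adj G z u.
Proof.
have MR : (sign_mx G <= R)%MS.
  by rewrite -(mxrank_leqif_sup odd3_sub) odd3_rank eqn_leq rk odd3_rank_ge3.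
have /submxP[w wP] : (row (enum_rank v) (sign_mx G) <= R)%MS.
  exact: submx_trans (row_sub _ _) MR.
exists w => u; move/rowP/(_ (enum_rank u)): wP.
rewrite !mxE !enum_rankK => ->; rewrite !big_ord_recl big_ord0 !mxE /=.
rewrite !enum_rankK addr0 addrA.
by congr (w 0 _ * _ + w 0 _ * _ + w 0 _ * _); apply: val_inj.
Qed.

(** Each coefficient of row [v] is half a sum of two signs, so it is 0, 1 or -1. Oddness leaves
    either exactly one nonzero coefficient or three, and the diagonal entry at [v] rules out
    three. *)
Lemma odd3_twin v : exists i s, forall u, adj G v u = s (+) adj G (t i) u.
Proof.
have [w wP] := odd3_span v.
(* The system for w given by the columns x, y, z, inverted by hand; oddness of
   the triple makes the cross terms cancel. *)
have key u : 2%:R * (-1) ^+ adj G v u =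
    ((-1) ^+ adj G x y * (-1) ^+ adj G v y
     + (-1) ^+ adj G x z * (-1) ^+ adj G v z)
      * (-1) ^+ adj G x u
  + ((-1) ^+ adj G x y * (-1) ^+ adj G v x
     + (-1) ^+ adj G y z * (-1) ^+ adj G v z)
      * (-1) ^+ adj G y u
  + ((-1) ^+ adj G x z * (-1) ^+ adj G v x
     + (-1) ^+ adj G y z * (-1) ^+ adj G v y)
      * (-1) ^+ adj G z u :> algC.
  rewrite !wP !(adj_irr G) (adj_sym G y x) (adj_sym G z x) (adj_sym G z y).
  move: xyz; rewrite /odd3.
  by case: (adj G x y); case: (adj G y z); case: (adj G x z) => // _;
    rewrite /= ?expr0 ?expr1; ring.
have n2 : 2%:R != 0 :> algC by rewrite pnatr_eq0.
have n8 : 8%:R != 0 :> algC by rewrite pnatr_eq0.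
have := key v.
rewrite (adj_irr G) (adj_sym G x v) (adj_sym G y v) (adj_sym G z v).
have fin (i : 'I_3) (s : bool) :
    (forall u, 2%:R * (-1) ^+ adj G v u
               = 2%:R * ((-1) ^+ s * (-1) ^+ adj G (t i) u) :> algC) ->
    exists i s, forall u, adj G v u = s (+) adj G (t i) u.
  move=> h; exists i, s => u; apply: (@signr_inj algC).
  by rewrite signr_addb; apply/(mulfI n2)/h.
move: key xyz fin; rewrite /odd3.
case: (adj G x y); case: (adj G y z); case: (adj G x z) => //;
case: (adj G v x); case: (adj G v y); case: (adj G v z) => key _ fin;
rewrite /= ?expr0 ?expr1 => kv;
(* Row v is a signed row of x, y or z, except in the case of three equal signs
   relative to them, where column v reads 2 = - 6. *)
first [ apply: (fin 0 true) => u; rewrite key /t /= ?expr0 ?expr1; ring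
      | apply: (fin 0 false) => u; rewrite key /t /= ?expr0 ?expr1; ring
      | apply: (fin 1 true) => u; rewrite key /t /= ?expr0 ?expr1; ring
      | apply: (fin 1 false) => u; rewrite key /t /= ?expr0 ?expr1; ring
      | apply: (fin 2 true) => u; rewrite key /t /= ?expr0 ?expr1; ring
      | apply: (fin 2 false) => u; rewrite key /t /= ?expr0 ?expr1; ring
      | case/eqP: n8; move/eqP: kv; rewrite -subr_eq0 => /eqP kv;
        rewrite -[RHS]kv; ring ].
Qed.
End OddTriple.

(** * Tripartitions: existence and characteristic polynomial *)

(* The switching of G with respect to the vertices where e holds is the complete
   tripartite graph whose parts are the fibers of c; parts may be empty. *)
Definition tripartition (T : finType) (G : sgraph T) (c : T -> 'I_3)
    (e : T -> bool) :=
  forall u v, adj G u v = e u (+) e v (+) (c u != c v).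

Definition part_size (T : finType) (c : T -> 'I_3) (i : 'I_3) : nat :=
  #|[pred u | c u == i]|.

Lemma sum_part_size (T : finType) (c : T -> 'I_3) :
  (part_size c 0%R + part_size c 1%R + part_size c 2%R)%N = #|T|.
Proof.
rewrite -sum1_card (partition_big c xpredT) //= !big_ord_recl big_ord0.
rewrite addn0 addnA.
by rewrite !sum1_card; congr (_ + _ + _)%N; apply: eq_card => u;
  rewrite !inE; congr (_ == _); apply: val_inj.
Qed.

Lemma odd3_tripartition (T : finType) (G : sgraph T) x y z :
  odd3 G x y z -> (\rank (sign_mx G) <= 3)%N ->
  exists c e, tripartition G c e.
Proof.
move=> xyz rk; pose t (i : 'I_3) := nth x [:: x; y; z] i.
have tw v : exists w : 'I_3 * bool,
    forall u, adj G v u = w.2 (+) adj G (t w.1) u.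
  by have [i [s]] := odd3_twin xyz rk v; exists (i, s).
have [f fP] := fin_all_exists tw.
(* Switching by [e0] turns the triple into a triangle: it makes [x] adjacent to both others, and
   oddness then makes [y] and [z] adjacent. *)
pose e0 (i : 'I_3) := nth false [:: false; ~~ adj G x y; ~~ adj G x z] i.
have tE i j : adj G (t i) (t j) = e0 i (+) e0 j (+) (i != j).
  move: xyz; rewrite /odd3 /t /e0.
  case: i j => [[|[|[|//]]] ?] [[|[|[|//]]] ?] /=;
  rewrite ?(adj_irr G) ?(adj_sym G y x) ?(adj_sym G z x) ?(adj_sym G z y) /=;
  by case: (adj G x y); case: (adj G x z); case: (adj G y z).
exists (fun u => (f u).1), (fun u => (f u).2 (+) e0 (f u).1) => u v.
rewrite fP (adj_sym G) fP (adj_sym G) tE.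
by case: (f u).2; case: (f v).2; case: (e0 _); case: (e0 _); case: eqP.
Qed.

Section Tripartition.
Variables (T : finType) (G : sgraph T) (c : T -> 'I_3) (e : T -> bool).
Hypothesis ce : tripartition G c e.

(** The signed incidence matrix of vertices and parts; [N] below is the sign matrix of a
    triangle. *)
Let B : 'M[algC]_(#|T|, 3) :=
  \matrix_(u, i) ((-1) ^+ e (enum_val u) * (c (enum_val u) == i)%:R).
Let N : 'M[algC]_3 := \matrix_(i, j) (-1) ^+ (i != j).

Lemma sign_mx_tripartition : sign_mx G = B *m (N *m B^T).
Proof.
apply/matrixP => u v; rewrite mxE ce !signr_addb.
rewrite mxE (bigD1 (c (enum_val u))) //= big1 => [|i /negPf ne]; last first.
  by rewrite mxE eq_sym ne mulr0 mul0r.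
rewrite !mxE (bigD1 (c (enum_val v))) //= big1 => [|i /negPf ne]; last first.
  by rewrite !mxE [c (enum_val v) == i]eq_sym ne !mulr0.
by rewrite !mxE !eqxx !addr0 !mulr1 -mulrA; congr (_ * _); rewrite mulrC.
Qed.

Lemma tripartition_rank : (\rank (sign_mx G) <= 3)%N.
Proof.
rewrite sign_mx_tripartition.
exact: leq_trans (mxrankM_maxl _ _) (rank_leq_col _).
Qed.

(** [B^T *m B] is diagonal with the part sizes as entries, since the signs square to 1. *)
Lemma tripartition_gram i j : (N *m B^T *m B) i j = N i j * (part_size c j)%:R.
Proof.
rewrite -mulmxA mxE (bigD1 j) //= big1 => [|k /negPf ne]; last first.
  rewrite [(B^T *m B) k j]mxE big1 ?mulr0 // => u _; rewrite !mxE.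
  have [->|] := eqVneq (c (enum_val u)) k; last by rewrite mulr0 mul0r.
  by rewrite ne !mulr0.
rewrite addr0; congr (_ * _); rewrite mxE.
under eq_bigr => u _ do
  rewrite !mxE mulrACA -signr_addb addbb mul1r -natrM mulnb andbb.
rewrite -natr_sum /part_size; congr _%:R.
rewrite -[RHS]sum1_card [RHS]big_mkcond /=.
rewrite [RHS](reindex (@enum_val T T)) /=; last exact/onW_bij/enum_val_bij.
by apply: eq_bigr => u _; rewrite inE; case: eqP.
Qed.

(** The shift to [y] replaces the Seidel matrix by the sign matrix, and Sylvester's identity reduces
    to a 3x3 determinant. Its linear term vanishes with the principal 2x2 minors of [N];
    [\det N = -4] yields the constant term. *)
Lemma tripartition_char_poly (y := 'X + 1 : {poly algC}) :
  y ^+ 3 * char_poly (seidel_mx G) =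
  y ^+ #|T| * (y ^+ 3 - #|T|%:R * y ^+ 2
    + (4 * (part_size c 0%R * part_size c 1%R * part_size c 2%R))%N%:R).
Proof.
have -> : char_poly (seidel_mx G) =
    \det (y%:M - map_mx polyC B *m map_mx polyC (N *m B^T)).
  rewrite -map_mxM -sign_mx_tripartition /char_poly /char_poly_mx seidel_mxE.
  congr (\det _); apply/matrixP => u v; rewrite !mxE polyCB polyCMn polyC1.
  by rewrite mulrnDl opprB addrA.
rewrite sylvester_det; congr (_ * _); rewrite -map_mxM.
have E i j : (y%:M - map_mx polyC (N *m B^T *m B)) i j =
    y *+ (i == j) - (-1) ^+ (i != j) * (part_size c j)%:R.
  rewrite 2!mxE [in X in _ + X]mxE [in X in _ - X]mxE tripartition_gram.
  by rewrite mxE polyCM rmorph_sign /= polyC_natr.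
rewrite det_mx33 !E /= ?mulr1n ?mulr0n ?expr0 ?expr1 -(sum_part_size c).
rewrite !natrD !natrM; ring.
Qed.
End Tripartition.

(** * Cospectrality of tripartitioned graphs *)

Lemma char_poly_spectrum n (A : 'M[algC]_n) :
  char_poly A = \prod_(z <- spectrum A) ('X - z%:P).
Proof.
rewrite /spectrum; case: closed_field_poly_normal => r /= {1}->.
by rewrite (monicP (char_poly_monic A)) scale1r.
Qed.

Lemma spectrum_perm_char_poly n m (A : 'M[algC]_n) (B : 'M[algC]_m) :
  perm_eq (spectrum A) (spectrum B) <-> char_poly A = char_poly B.
Proof.
split=> [AB|AB]; first by rewrite !char_poly_spectrum (perm_big _ AB).
by apply: prod_XsubC_eq; rewrite -!char_poly_spectrum.
Qed.

Lemma X1_expn_neq0 n : ('X + 1) ^+ n != 0 :> {poly algC}.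
Proof. by rewrite expf_neq0 // -size_poly_eq0 -[1]polyC1 size_XaddC. Qed.

Lemma tripartition_cospectral (T T' : finType) (G : sgraph T) (H : sgraph T')
    c e c' e' :
  tripartition G c e -> tripartition H c' e' ->
  seidel_cospectral G H <->
  #|T| = #|T'| /\
  (part_size c 0%R * part_size c 1%R * part_size c 2%R =
   part_size c' 0%R * part_size c' 1%R * part_size c' 2%R)%N.
Proof.
move=> Gce Hce; have := tripartition_char_poly Gce.
have := tripartition_char_poly Hce => /= EH EG.
rewrite /seidel_cospectral spectrum_perm_char_poly; split=> [GH|[nn pp]].
  have nn : #|T| = #|T'|.
    apply/succn_inj.
    by rewrite -(size_char_poly (seidel_mx G)) GH size_char_poly.
  split=> //; move: EG; rewrite GH EH nn => /(mulfI (X1_expn_neq0 _))/addrI/eqP.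
  by rewrite -!polyC_natr (inj_eq polyC_inj) eqr_nat eqn_pmul2l // => /eqP.
by apply/(mulfI (X1_expn_neq0 3)); rewrite EG EH nn pp.
Qed.

(** * Uniqueness of the parts, and isomorphism from equal part sizes *)

(* The fibers of a surjective c' are the classes of rows equal up to sign. *)
Lemma tripartition_twin (T : finType) (G : sgraph T) c e c' e' u v :
  tripartition G c e -> tripartition G c' e' ->
  (forall i, exists w, c' w = i) ->
  c u = c v -> c' u = c' v.
Proof.
move=> ce ce' c'_surj cuv; apply/eqP/negPn/negP => c'uv.
(* A vertex [w] of the third part tests the rows of [u] and [v]: by [c] their ratio is the same in
   every column, whereas by [c'] it differs between columns [u] and [w]. *)
have [k /andP[ku kv]] : exists k, (c' u != k) && (c' v != k).
  by move: c'uv; case: (c' u) (c' v) => [[|[|[|//]]] ?] [[|[|[|//]]] ?] //= _;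
    [exists 2|exists 1|exists 2|exists 0|exists 1|exists 0].
have [w c'w] := c'_surj k.
have := ce u u; have := ce v u; have := ce u w; have := ce v w.
rewrite !ce' cuv c'w ku kv !eqxx [c' v == _]eq_sym c'uv.
by case: (e u); case: (e v); case: (e w); case: (c v == c w);
  case: (e' u); case: (e' v); case: (e' w).
Qed.

(** Within each fiber, the k-th element in enumeration order is sent to the k-th element of the
    matching fiber. *)
Lemma fiber_bij (I T T' : finType) (c : T -> I) (d : T' -> I) :
  (forall i, #|[pred u | c u == i]| = #|[pred v | d v == i]|) ->
  exists2 f : T -> T', bijective f & forall u, d (f u) = c u.
Proof.
move=> cd; pose E i := enum [pred u | c u == i].
pose E' i := enum [pred v | d v == i].
have ex u : exists v, d v = c u /\ index v (E' (c u)) = index u (E (c u)).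
  have uE : u \in E (c u) by rewrite mem_enum inE.
  have lt : (index u (E (c u)) < size (E' (c u)))%N.
    by rewrite -cardE -cd cardE index_mem.
  have [v0 v0E'] : exists v0, v0 \in E' (c u).
    by case: (E' _) lt => // v0 s _; exists v0; rewrite mem_head.
  exists (nth v0 (E' (c u)) (index u (E (c u)))); split; last first.
    by rewrite index_uniq ?enum_uniq.
  by have := mem_nth v0 lt; rewrite mem_enum inE => /eqP.
have [f fP] := fin_all_exists ex.
exists f; last by move=> u; case: (fP u).
apply: inj_card_bij => [u v fuv|].
  have [du iu] := fP u; have [dv iv] := fP v.
  have cuv : c u = c v by rewrite -du -dv fuv.
  have uE : u \in E (c u) by rewrite mem_enum inE.
  have vE : v \in E (c u) by rewrite mem_enum inE cuv.
  rewrite -(nth_index u uE) -[RHS](nth_index u vE); congr nth.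
  by rewrite -iu fuv cuv iv.
rewrite -!sum1_card (partition_big d xpredT) //= (partition_big c xpredT) //=.
rewrite leq_eqVlt; apply/orP; left; apply/eqP; apply: eq_bigr => i _.
by rewrite !sum1_card cd.
Qed.

Lemma complete_multipartite_tripartition a b d :
  @tripartition _ (complete_multipartite [:: a; b; d]) tag (fun=> false).
Proof. by []. Qed.

Lemma card_multipartite_part s (i : 'I_(size s)) :
  #|[pred u : multipartite_vertex s | tag u == i]| = nth 0%N s i.
Proof.
have inj : injective (fun k : 'I_(nth 0%N s i) =>
    Tagged (fun i : 'I_(size s) => 'I_(nth 0%N s i)) k).
  by move=> k l /eqP; rewrite eq_Tagged => /eqP.
rewrite -[RHS]card_ord -(card_codom inj); apply: eq_card => -[j k].
rewrite inE /=.
apply/eqP/codomP => [ji|[l /(congr1 tag)]] //.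
by case: i / ji {inj} => //=; exists k.
Qed.

Lemma part_size_multipartite a b d :
  let ps := @part_size (multipartite_vertex [:: a; b; d]) tag in
  [/\ ps 0 = a, ps 1 = b & ps 2 = d].
Proof. by split; rewrite /part_size card_multipartite_part. Qed.

Lemma multipartite_tag_surj a b d (i : 'I_3) :
  (0 < a)%N -> (0 < b)%N -> (0 < d)%N ->
  exists u : multipartite_vertex [:: a; b; d], tag u = i.
Proof.
move=> a0 b0 d0; have lt : (0 < nth 0%N [:: a; b; d] i)%N.
  by case: i => [[|[|[|//]]] ?].
by exists (Tagged (fun i : 'I_3 => 'I_(nth 0%N [:: a; b; d] i)) (Ordinal lt)).
Qed.

Lemma card_multipartite3 a b d :
  #|{: multipartite_vertex [:: a; b; d]}| = (a + b + d)%N.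
Proof.
have [e0 e1 e2] := part_size_multipartite a b d.
rewrite -(@sum_part_size (multipartite_vertex [:: a; b; d]) tag).
by congr (_ + _ + _)%N.
Qed.

Lemma bij_part_size (T : finType) (c : T -> 'I_3) (s : 'S_3) i :
  part_size (s \o c) (s i) = part_size c i.
Proof. by apply: eq_card => u; rewrite !inE (inj_eq perm_inj). Qed.

Lemma perm_part_size (T T' : finType) (c : T -> 'I_3) (d : T' -> 'I_3) :
  perm_eq [:: part_size c 0%R; part_size c 1%R; part_size c 2%R]
          [:: part_size d 0%R; part_size d 1%R; part_size d 2%R] ->
  exists s : 'S_3, forall i, part_size c i = part_size d (s i).
Proof.
have tE (T0 : finType) (f : T0 -> 'I_3) i :
    part_size f i =
    tnth [tuple part_size f 0%R; part_size f 1%R; part_size f 2%R] i.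
  by case: i => [[|[|[|//]]] ?]; rewrite (tnth_nth 0%N) /=; congr part_size;
    apply: val_inj.
move=> cd; have /tuple_permP[s sE] : perm_eq
  [tuple part_size c 0%R; part_size c 1%R; part_size c 2%R]
  [tuple part_size d 0%R; part_size d 1%R; part_size d 2%R] by [].
exists s => i; rewrite (tE T') (tE T) (val_inj sE).
by rewrite tnth_mktuple.
Qed.

Lemma tripartition_isomorphic (T T' : finType) (H : sgraph T) (G : sgraph T')
    c e d :
  tripartition H c e -> tripartition G d (fun=> false) ->
  perm_eq [:: part_size c 0%R; part_size c 1%R; part_size c 2%R]
          [:: part_size d 0%R; part_size d 1%R; part_size d 2%R] ->
  exists2 G' : sgraph T, switching_equivalent H G' & isomorphic G' G.
Proof.
(* Switching at the support of [e] cancels the signs; [s] then matches parts of equal size. *)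
move=> Hce Gd /perm_part_size[s sP]; exists (switching H [set u | e u]).
  by exists [set u | e u].
have [i|f f_bij fP] := @fiber_bij _ _ _ (s \o c) d.
  by rewrite -[i](permKV s); have := bij_part_size c s (s^-1%g i); rewrite sP.
exists f => // x y; rewrite Gd !fP /= (inj_eq perm_inj) /switch_adj !inE Hce.
by case: (e x); case: (e y); case: (c x != c y).
Qed.

(** * The criterion for being determined, and the counterexamples *)

Lemma S_determined_tripartite (p q r : nat) :
  (0 < p)%N -> (0 < q)%N -> (0 < r)%N ->
  (forall a b d : nat, (a + b + d = p + q + r)%N -> (a * b * d = p * q * r)%N ->
     perm_eq [:: a; b; d] [:: p; q; r]) ->
  S_determined (complete_multipartite [:: p; q; r]).
Proof.
move=> p0 q0 r0 uniq T H HK.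
have Ktri := @complete_multipartite_tripartition p q r.
set K := complete_multipartite _ in HK Ktri *.
have rkE : \rank (sign_mx H) = \rank (sign_mx K).
  have /spectrum_perm_char_poly cp := HK.
  apply: (@addIn (mup (- 1) (char_poly (seidel_mx K)))).
  rewrite seidel_rank -{1}cp seidel_rank; apply/succn_inj.
  by rewrite -(size_char_poly (seidel_mx H)) cp size_char_poly.
(* One vertex from each part gives a triangle, which is an odd triple. *)
have rk3 : (2 < \rank (sign_mx K))%N.
  have [x x0] := multipartite_tag_surj 0 p0 q0 r0.
  have [y y1] := multipartite_tag_surj 1 p0 q0 r0.
  have [z z2] := multipartite_tag_surj 2 p0 q0 r0.
  by apply: (@odd3_rank_ge3 _ K x y z); rewrite /odd3 !Ktri x0 y1 z2.
have [x [y [z xyz]]] : exists x y z, odd3 H x y z.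
  by apply: exists_odd3; rewrite rkE ltnW.
have [|c [e Hce]] := odd3_tripartition xyz.
  by rewrite rkE (tripartition_rank Ktri).
have [nE pE] := (tripartition_cospectral Hce Ktri).1 HK.
apply: (tripartition_isomorphic Hce Ktri).
have [k0 k1 k2] := part_size_multipartite p q r.
rewrite /= in k0 k1 k2; rewrite k0 k1 k2; apply: uniq.
  by rewrite sum_part_size nE card_multipartite3.
by rewrite pE k0 k1 k2.
Qed.

(** An isomorphism from a switching of [H] to [K] would carry each part of [H] into a part of [K].
    The part of [H] meeting the preimage of the singleton part has at least two vertices,
    contradicting injectivity. *)
Lemma not_S_determined_tripartite (p q a b d : nat) : (0 < p)%N -> (0 < q)%N ->
  (1 < a)%N -> (1 < b)%N -> (1 < d)%N ->
  (a + b + d = p + q + 1)%N -> (a * b * d = p * q * 1)%N ->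
  ~ S_determined (complete_multipartite [:: p; q; 1%N]).
Proof.
move=> p0 q0 a1 b1 d1 sE pE detK.
have Ktri := @complete_multipartite_tripartition p q 1.
have Htri := @complete_multipartite_tripartition a b d.
set K := complete_multipartite _ in detK Ktri.
set H := complete_multipartite _ in Htri.
have [k0 k1 k2] := part_size_multipartite p q 1; rewrite /= in k0 k1 k2.
have [h0 h1 h2] := part_size_multipartite a b d; rewrite /= in h0 h1 h2.
have [|G [U GU] [f [g fK gK] fG]] := detK _ H.
  apply/(tripartition_cospectral Htri Ktri).
  by rewrite k0 k1 k2 h0 h1 h2 !card_multipartite3.
have Gtri1 : tripartition G tag (fun u => u \in U).
  move=> u v; rewrite GU /= /switch_adj Htri.
  by case: (u \in U); case: (v \in U); case: (tag u != tag v).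
have Gtri2 : @tripartition _ G (tag \o f) (fun=> false).
  by move=> u v; rewrite -fG Ktri.
have surj i : exists w, (tag \o f) w = i.
  by have [w wi] := multipartite_tag_surj i p0 q0 (ltn0Sn 0);
    exists (g w); rewrite /= gK.
have [u u2] := surj 2.
have /card_gt1P[v [w [vu wu vw]]] :
    (1 < #|[pred v : multipartite_vertex [:: a; b; d] | tag v == tag u]|)%N.
  by rewrite card_multipartite_part; case: (tag u) => [[|[|[|//]]] ?].
rewrite !inE in vu wu.
have f2 x : tag x == tag u -> f x \in [pred y | tag y == 2].
  move=> /eqP xu; rewrite inE -u2; apply/eqP.
  exact: (tripartition_twin Gtri1 Gtri2 surj xu).
have /card_le1P/(_ _ (f2 _ vu))/(_ (f w)) :
    (#|[pred y : multipartite_vertex [:: p; q; 1%N] | tag y == 2%R]| <= 1)%N.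
  by rewrite card_multipartite_part.
rewrite f2 // => /esym/eqP/(can_inj fK) wv.
by rewrite wv eqxx in vw.
Qed.

Local Close Scope ring_scope.

Theorem theorem4p8 (q : nat) (q_gt0 : 0 < q) :
  (q <= 4 ->
     forall p : nat, 0 < p -> S_determined (complete_multipartite [:: p; q; 1])) /\
  (4 < q ->
     exists p : nat,
       0 < p /\ ~ S_determined (complete_multipartite [:: p; q; 1])).
Proof.
split=> [q4 p p_gt0|q4].
  apply: S_determined_tripartite => // a b d.
  by apply: sum_prod_perm3; rewrite ?q_gt0.
have [p [a [b [p_gt0 a1 b1 sE pE]]]] := sum_prod_witness q4.
by exists p; split=> //; apply: (not_S_determined_tripartite _ _ a1 b1 _ sE pE).
Qed.
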